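(* Let $f,g$ be arrow terms of $\mathbf{L}_{\top,\bot}$ of the same type such that $Gf\neq Gg$. Then every dicartesian category $\mathcal{A}$ that satisfies the equation $f=g$ also satisfies the following: for every object $a$ of $\mathcal{A}$, $$\check k^1_{a,\top}\circ\hat k^1_{a,\bot}=\check k^2_{a,\top}\circ\mathbf{0}_{\bot,\top}\circ\hat k^2_{a,\bot},$$ and for all arrows $u,v:a\to b$ of $\mathcal{A}$ with the same source and the same target, $$\check k^1_{b,\top}\circ u\circ\hat k^1_{a,\bot}=\check k^1_{b,\top}\circ v\circ\hat k^1_{a,\bot}.$$
   Context: Formulae: $\mathcal{L}_{\top,\bot}$ is the set of formulae built from infinitely many propositional letters and the propositional constants $\top,\bot$ with the binary connectives $\wedge$ and $\vee$; $\xi$ stands for either $\wedge$ or $\vee$. The category $\mathbf{L}_{\top,\bot}$: its objects are the formulae of $\mathcal{L}_{\top,\bot}$. Arrow terms are typed expressions, where $f:A\vdash B$ means that $f$ has source $A$ and target $B$. For all formulae $A,A_1,A_2$ and $i\in\{1,2\}$ the primitive arrow terms are $\mathbf{1}_A:A\vdash A$, $\hat w_A:A\vdash A\wedge A$, $\check w_A:A\vee A\vdash A$, $\hat k^i_{A_1,A_2}:A_1\wedge A_2\vdash A_i$, $\check k^i_{A_1,A_2}:A_i\vdash A_1\vee A_2$, $\hat\kappa_A:A\vdash\top$, $\check\kappa_A:\bot\vdash A$. If $f:A\vdash B$ and $g:B\vdash C$ are arrow terms, so is $g\circ f:A\vdash C$; if $f_j:A_j\vdash B_j$ ($j=1,2$)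 are arrow terms, so is $f_1\mathbin{\xi}f_2:A_1\mathbin{\xi}A_2\vdash B_1\mathbin{\xi}B_2$. The equations of $\mathbf{L}_{\top,\bot}$ are the smallest set of equations between arrow terms of the same type that contains all instances of $f=f$ and of the following, and is closed under symmetry, transitivity and congruence with respect to $\circ$, $\wedge$ and $\vee$ on arrow terms: categorial: $f\circ\mathbf{1}_A=\mathbf{1}_B\circ f=f$ for $f:A\vdash B$, $h\circ(g\circ f)=(h\circ g)\circ f$; bifunctorial: $\mathbf{1}_A\mathbin{\xi}\mathbf{1}_B=\mathbf{1}_{A\xi B}$, $(g_1\circ f_1)\mathbin{\xi}(g_2\circ f_2)=(g_1\mathbin{\xi}g_2)\circ(f_1\mathbin{\xi}f_2)$; naturality (for $f:A\vdash B$, $f_j:A_j\vdash B_j$): $(f\wedge f)\circ\hat w_A=\hat w_B\circ f$, $f\circ\check w_A=\check w_B\circ(f\vee f)$, $f_i\circ\hat k^i_{A_1,A_2}=\hat k^i_{B_1,B_2}\circ(f_1\wedge f_2)$, $(f_1\vee f_2)\circ\check k^i_{A_1,A_2}=\check k^i_{B_1,B_2}\circ f_i$; triangular: $\hat k^i_{A,A}\circ\hat w_A=\mathbf{1}_A$, $\check w_A\circ\check k^i_{A,A}=\mathbf{1}_A$, $(\hat k^1_{A,B}\wedge\hat k^2_{A,B})\circ\hat w_{A\wedge B}=\mathbf{1}_{A\wedge B}$, $\check w_{A\vee B}\circ(\check k^1_{A,B}\vee\check k^2_{A,B})=\mathbf{1}_{A\vee B}$; terminal/initial: $\hat\kappa_A=f$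 for every $f:A\vdash\top$, $\check\kappa_A=g$ for every $g:\bot\vdash A$; $\hat k^1_{\bot,\bot}=\hat k^2_{\bot,\bot}$ and $\check k^1_{\top,\top}=\check k^2_{\top,\top}$. Arrows of $\mathbf{L}_{\top,\bot}$ are equivalence classes of arrow terms modulo these equations. A dicartesian category is a category of the kind of which $\mathbf{L}_{\top,\bot}$ is the one freely generated by the set of letters: a category with chosen binary products $\wedge$ (projections $\hat k^i$, diagonals $\hat w$), chosen binary coproducts $\vee$ (injections $\check k^i$, codiagonals $\check w$), a terminal object $\top$ (unique arrows $\hat\kappa_a:a\to\top$) and an initial object $\bot$ (unique arrows $\check\kappa_a:\bot\to a$), in which $\hat k^1_{\bot,\bot}=\hat k^2_{\bot,\bot}:\bot\wedge\bot\to\bot$ and $\check k^1_{\top,\top}=\check k^2_{\top,\top}:\top\to\top\vee\top$. A dicartesian category $\mathcal{A}$ satisfies an equation $f=g$ between arrow terms of $\mathbf{L}_{\top,\bot}$ when, for every assignment of objects of $\mathcal{A}$ to propositional letters, the induced interpretations of $f$ and $g$ in $\mathcal{A}$ are equal arrows. $\mathbf{0}_{\bot,\top}:\bot\to\top$ denotes the unique arrow $\hat\kappa_{\bot}=\check\kappa_{\top}$. The category $\mathit{Rel}$ and the functor $G$: objects of $\mathit{Rel}$ are the formulae of $\mathcal{L}_{\top,\bot}$; an arrow $R:A\vdash B$ is a binary relation from the set of occurrences of propositional letters in $A$ to the set of occurrences of propositional letters in $B$ (constants $\top,\bot$ are not letters); composition is $R_2\circ R_1=\{(x,y)\mid\exists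 z\,(xR_1z\text{ and }zR_2y)\}$, identities are identity relations. Let $|A|$ be the number of letter occurrences in $A$ and $x_j(A)$ the $j$-th one from the left. $R_1\mathbin{\xi}R_2$ is the disjoint union of $R_1$ and $R_2$ placed side by side: it consists of the pairs $(x_j(A_1\xi A_2),x_k(B_1\xi B_2))$ with $(x_j(A_1),x_k(B_1))\in R_1$ and $(x_{j+|A_1|}(A_1\xi A_2),x_{k+|B_1|}(B_1\xi B_2))$ with $(x_j(A_2),x_k(B_2))\in R_2$. The functor $G:\mathbf{L}_{\top,\bot}\to\mathit{Rel}$ is the identity on objects, preserves identities, $\circ$, $\wedge$, $\vee$, and satisfies: $(x_j(A),x_k(A\wedge A))\in G\hat w_A$ iff $(x_k(A\vee A),x_j(A))\in G\check w_A$ iff $j\equiv k\pmod{|A|}$; $(x_j(A_1\wedge A_2),x_k(A_1))\in G\hat k^1_{A_1,A_2}$ iff $(x_k(A_1),x_j(A_1\vee A_2))\in G\check k^1_{A_1,A_2}$ iff $j=k$; $(x_j(A_1\wedge A_2),x_k(A_2))\in G\hat k^2_{A_1,A_2}$ iff $(x_k(A_2),x_j(A_1\vee A_2))\in G\check k^2_{A_1,A_2}$ iff $j=k+|A_1|$; and $G\hat\kappa_A=G\check\kappa_A=\emptyset$. *)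

(* Defs.v *)
From mathcomp Require Import all_boot.

Set Implicit Arguments.
Unset Strict Implicit.
Unset Printing Implicit Defensive.

Inductive formula : Type :=
| Letter of nat
| Top
| Bot
| And of formula & formula
| Or of formula & formula.

(* The suffixes H (hat) and C (check) distinguish the conjunctive and the
   disjunctive versions of the primitive arrow terms. *)
Inductive term : formula -> formula -> Type :=
| Id A : term A A
| WH A : term A (And A A)
| WC A : term (Or A A) A
| K1H A1 A2 : term (And A1 A2) A1
| K2H A1 A2 : term (And A1 A2) A2
| K1C A1 A2 : term A1 (Or A1 A2)
| K2C A1 A2 : term A2 (Or A1 A2)
| KappaH A : term A Top
| KappaC A : term Bot A
| Comp A B C : term B C -> term A B -> term A C
| AndT A1 A2 B1 B2 :
    term A1 B1 -> term A2 B2 -> term (And A1 A2) (And B1 B2)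
| OrT A1 A2 B1 B2 :
    term A1 B1 -> term A2 B2 -> term (Or A1 A2) (Or B1 B2).

Fixpoint nletters (A : formula) : nat :=
  match A with
  | Letter _ => 1
  | Top | Bot => 0
  | And A1 A2 | Or A1 A2 => nletters A1 + nletters A2
  end.

(* The occurrences of letters in A are identified with the ordinals below
   nletters A: the ordinal j stands for the (j+1)-th occurrence from the left.
   The congruence and the equalities between positions that define G are
   unaffected by counting from 0. *)
Definition Rel (A B : formula) : Type :=
  {set 'I_(nletters A) * 'I_(nletters B)}.

Definition rel_id (A : formula) : Rel A A := [set p | p.1 == p.2].

Definition rel_comp (A B C : formula) (R2 : Rel B C) (R1 : Rel A B) : Rel A C :=
  [set p | [exists z, ((p.1, z) \in R1) && ((z, p.2) \in R2)]].

Definition rel_juxt (m1 n1 m2 n2 : nat)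
    (R1 : {set 'I_m1 * 'I_n1}) (R2 : {set 'I_m2 * 'I_n2}) :
    {set 'I_(m1 + m2) * 'I_(n1 + n2)} :=
  [set (lshift m2 p.1, lshift n2 p.2) | p in R1]
    :|: [set (rshift m1 p.1, rshift n1 p.2) | p in R2].

Fixpoint G (A B : formula) (f : term A B) : Rel A B :=
  match f in term A B return Rel A B with
  | Id A => rel_id A
  | WH A => [set p : 'I_(nletters A) * 'I_(nletters (And A A))
              | p.1 == p.2 %[mod nletters A]]
  | WC A => [set p : 'I_(nletters (Or A A)) * 'I_(nletters A)
              | p.2 == p.1 %[mod nletters A]]
  | K1H A1 A2 => [set p : 'I_(nletters (And A1 A2)) * 'I_(nletters A1)
                   | p.1 == p.2 :> nat]
  | K2H A1 A2 => [set p : 'I_(nletters (And A1 A2)) * 'I_(nletters A2)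
                   | p.1 == p.2 + nletters A1 :> nat]
  | K1C A1 A2 => [set p : 'I_(nletters A1) * 'I_(nletters (Or A1 A2))
                   | p.2 == p.1 :> nat]
  | K2C A1 A2 => [set p : 'I_(nletters A2) * 'I_(nletters (Or A1 A2))
                   | p.2 == p.1 + nletters A1 :> nat]
  | KappaH A => set0
  | KappaC A => set0
  | Comp A B C g f => rel_comp (G g) (G f)
  | AndT A1 A2 B1 B2 f1 f2 => rel_juxt (G f1) (G f2)
  | OrT A1 A2 B1 B2 f1 f2 => rel_juxt (G f1) (G f2)
  end.

Declare Scope cat_scope.
Delimit Scope cat_scope with cat.
Local Open Scope cat_scope.

Record category := Category {
  obj :> Type;
  hom : obj -> obj -> Type;
  idm : forall a, hom a a;
  compm : forall a b c, hom b c -> hom a b -> hom a c;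
  compm1 : forall a b (f : hom a b), compm f (idm a) = f;
  comp1m : forall a b (f : hom a b), compm (idm b) f = f;
  compmA : forall a b c d (h : hom c d) (g : hom b c) (f : hom a b),
    compm h (compm g f) = compm (compm h g) f
}.

Arguments hom {_} _ _.
Arguments idm {_} a.
Arguments compm {_ a b c} g f.

Notation "g ∘ f" := (compm g f) (at level 40, left associativity) : cat_scope.

(* Products and coproducts are presented equationally: the operations meetm
   and joinm on arrows are part of the structure, and the naturality and
   triangular equations force them to be the usual product and coproduct of
   arrows. *)
Record dicartesian := Dicartesian {
  dcat :> category;
  meet : dcat -> dcat -> dcat;
  join : dcat -> dcat -> dcat;
  top : dcat;
  bot : dcat;
  meetm : forall a1 a2 b1 b2 : dcat,
    hom a1 b1 -> hom a2 b2 -> hom (meet a1 a2) (meet b1 b2);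
  joinm : forall a1 a2 b1 b2 : dcat,
    hom a1 b1 -> hom a2 b2 -> hom (join a1 a2) (join b1 b2);
  wH : forall a : dcat, hom a (meet a a);
  wC : forall a : dcat, hom (join a a) a;
  k1H : forall a1 a2 : dcat, hom (meet a1 a2) a1;
  k2H : forall a1 a2 : dcat, hom (meet a1 a2) a2;
  k1C : forall a1 a2 : dcat, hom a1 (join a1 a2);
  k2C : forall a1 a2 : dcat, hom a2 (join a1 a2);
  kappaH : forall a : dcat, hom a top;
  kappaC : forall a : dcat, hom bot a;

  meetm1 : forall a b : dcat, meetm (idm a) (idm b) = idm (meet a b);
  joinm1 : forall a b : dcat, joinm (idm a) (idm b) = idm (join a b);
  meetm_comp : forall (a1 a2 b1 b2 c1 c2 : dcat)
      (g1 : hom b1 c1) (f1 : hom a1 b1) (g2 : hom b2 c2) (f2 : hom a2 b2),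
    meetm (g1 ∘ f1) (g2 ∘ f2) = meetm g1 g2 ∘ meetm f1 f2;
  joinm_comp : forall (a1 a2 b1 b2 c1 c2 : dcat)
      (g1 : hom b1 c1) (f1 : hom a1 b1) (g2 : hom b2 c2) (f2 : hom a2 b2),
    joinm (g1 ∘ f1) (g2 ∘ f2) = joinm g1 g2 ∘ joinm f1 f2;

  wH_nat : forall (a b : dcat) (f : hom a b), meetm f f ∘ wH a = wH b ∘ f;
  wC_nat : forall (a b : dcat) (f : hom a b), f ∘ wC a = wC b ∘ joinm f f;
  k1H_nat : forall (a1 a2 b1 b2 : dcat) (f1 : hom a1 b1) (f2 : hom a2 b2),
    f1 ∘ k1H a1 a2 = k1H b1 b2 ∘ meetm f1 f2;
  k2H_nat : forall (a1 a2 b1 b2 : dcat) (f1 : hom a1 b1) (f2 : hom a2 b2),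
    f2 ∘ k2H a1 a2 = k2H b1 b2 ∘ meetm f1 f2;
  k1C_nat : forall (a1 a2 b1 b2 : dcat) (f1 : hom a1 b1) (f2 : hom a2 b2),
    joinm f1 f2 ∘ k1C a1 a2 = k1C b1 b2 ∘ f1;
  k2C_nat : forall (a1 a2 b1 b2 : dcat) (f1 : hom a1 b1) (f2 : hom a2 b2),
    joinm f1 f2 ∘ k2C a1 a2 = k2C b1 b2 ∘ f2;

  k1H_wH : forall a : dcat, k1H a a ∘ wH a = idm a;
  k2H_wH : forall a : dcat, k2H a a ∘ wH a = idm a;
  wC_k1C : forall a : dcat, wC a ∘ k1C a a = idm a;
  wC_k2C : forall a : dcat, wC a ∘ k2C a a = idm a;
  meetm_kH_wH : forall a b : dcat,
    meetm (k1H a b) (k2H a b) ∘ wH (meet a b) = idm (meet a b);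
  wC_joinm_kC : forall a b : dcat,
    wC (join a b) ∘ joinm (k1C a b) (k2C a b) = idm (join a b);

  kappaH_uniq : forall (a : dcat) (f : hom a top), kappaH a = f;
  kappaC_uniq : forall (a : dcat) (f : hom bot a), kappaC a = f;

  k12H_bot : k1H bot bot = k2H bot bot;
  k12C_top : k1C top top = k2C top top
}.

Arguments meet {_} _ _.
Arguments join {_} _ _.
Arguments top {_}.
Arguments bot {_}.
Arguments meetm {_ a1 a2 b1 b2} _ _.
Arguments joinm {_ a1 a2 b1 b2} _ _.
Arguments wH {_} a.
Arguments wC {_} a.
Arguments k1H {_} a1 a2.
Arguments k2H {_} a1 a2.
Arguments k1C {_} a1 a2.
Arguments k2C {_} a1 a2.
Arguments kappaH {_} a.
Arguments kappaC {_} a.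

Definition zero_bot_top (D : dicartesian) : hom (bot : D) (top : D) :=
  kappaH bot.
Arguments zero_bot_top {D}.

Lemma zero_bot_topE (D : dicartesian) :
  zero_bot_top = kappaC top :> hom (bot : D) top.
Proof. by rewrite /zero_bot_top -(kappaC_uniq (kappaH bot)). Qed.

Fixpoint interp_obj (D : dicartesian) (v : nat -> D) (A : formula) : D :=
  match A with
  | Letter p => v p
  | Top => top
  | Bot => bot
  | And A1 A2 => meet (interp_obj v A1) (interp_obj v A2)
  | Or A1 A2 => join (interp_obj v A1) (interp_obj v A2)
  end.

Fixpoint interp (D : dicartesian) (v : nat -> D) (A B : formula)
    (f : term A B) : hom (interp_obj v A) (interp_obj v B) :=
  match f in term A B return hom (interp_obj v A) (interp_obj v B) with
  | Id A => idm (interp_obj v A)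
  | WH A => wH (interp_obj v A)
  | WC A => wC (interp_obj v A)
  | K1H A1 A2 => k1H (interp_obj v A1) (interp_obj v A2)
  | K2H A1 A2 => k2H (interp_obj v A1) (interp_obj v A2)
  | K1C A1 A2 => k1C (interp_obj v A1) (interp_obj v A2)
  | K2C A1 A2 => k2C (interp_obj v A1) (interp_obj v A2)
  | KappaH A => kappaH (interp_obj v A)
  | KappaC A => kappaC (interp_obj v A)
  | Comp A B C g f => interp v g ∘ interp v f
  | AndT A1 A2 B1 B2 f1 f2 => meetm (interp v f1) (interp v f2)
  | OrT A1 A2 B1 B2 f1 f2 => joinm (interp v f1) (interp v f2)
  end.

Definition satisfies (D : dicartesian) (A B : formula) (f g : term A B) : Prop :=
  forall v : nat -> D, interp v f = interp v g.

(* Main.v *)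
Require Import Defs.
From mathcomp Require Import all_boot.

Set Implicit Arguments.
Unset Strict Implicit.
Unset Printing Implicit Defensive.

Local Open Scope cat_scope.

(** Fix an object [a], interpret every letter as [a], and compare the two
    arrows [k1C a top ∘ k1H a bot] and [k2C a top ∘ zero_bot_top ∘ k2H a bot]
    from [meet a bot] to [join a top]. The second one has an empty graph, and
    the idea is to cut [f] and [g] down to these two arrows: for an occurrence
    [x] in [A] and an occurrence [y] in [B] there are arrows
    [meet a bot -> A] and [B -> join a top] that meet only [x] and only [y],
    and between them an arrow term becomes the first arrow if [(x, y)] is in
    its graph and the second one otherwise. An [(x, y)] that distinguishes
    [G f] from [G g] thus makes the two arrows equal in any dicartesian
    category that satisfies [f = g].

    An arrow term composed with an arrow that meets only [x] may give an arrow
    that meets several occurrences, or none; so the induction on arrow terms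
    needs all the arrows [meet a bot -> A] that can occur. They are indexed by
    the interpretation [elt A] of [A] in pointed sets, with letters read as the
    booleans pointed at [false]. Arrow terms act on [elt] by [act]; the
    arrow [point t] that realizes an element [t] satisfies
    [interp f ∘ point t = point (act f t)] ([interp_point]), and the support of
    an element, the set of occurrences at which it is [true], is transformed by
    [act f] as by the relation [G f] ([supp_act]). Finally [probe y] after
    [point t] is one of the two arrows, according to whether [y] is in the
    support of [t] ([probe_point]).

    The assertion on parallel arrows [u] and [v] follows: [k1C b top ∘ u] is
    [joinm u (idm top) ∘ k1C a top], and on [k2C a top] the arrow
    [joinm u (idm top)] does not depend on [u]. *)

(** * Products and coproducts in a dicartesian category *)

Section Pairing.
Variable D : dicartesian.

Definition pairm (c a b : D) (u : hom c a) (v : hom c b) : hom c (meet a b) :=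
  meetm u v ∘ wH c.

Definition copairm (a b c : D) (u : hom a c) (v : hom b c) : hom (join a b) c :=
  wC c ∘ joinm u v.

Lemma k1H_pairm (c a b : D) (u : hom c a) (v : hom c b) :
  k1H a b ∘ pairm u v = u.
Proof. by rewrite compmA -k1H_nat -compmA k1H_wH compm1. Qed.

Lemma k2H_pairm (c a b : D) (u : hom c a) (v : hom c b) :
  k2H a b ∘ pairm u v = v.
Proof. by rewrite compmA -k2H_nat -compmA k2H_wH compm1. Qed.

Lemma meetm_pairm (c a1 a2 b1 b2 : D) (f1 : hom a1 b1) (f2 : hom a2 b2)
    (u1 : hom c a1) (u2 : hom c a2) :
  meetm f1 f2 ∘ pairm u1 u2 = pairm (f1 ∘ u1) (f2 ∘ u2).
Proof. by rewrite /pairm compmA meetm_comp. Qed.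

Lemma pairm_diag (c a : D) (u : hom c a) : pairm u u = wH a ∘ u.
Proof. exact: wH_nat. Qed.

Lemma copairm_k1C (a b c : D) (u : hom a c) (v : hom b c) :
  copairm u v ∘ k1C a b = u.
Proof. by rewrite -compmA k1C_nat compmA wC_k1C comp1m. Qed.

Lemma copairm_k2C (a b c : D) (u : hom a c) (v : hom b c) :
  copairm u v ∘ k2C a b = v.
Proof. by rewrite -compmA k2C_nat compmA wC_k2C comp1m. Qed.

Lemma top_eq (a : D) (u v : hom a top) : u = v.
Proof. by rewrite -(kappaH_uniq u) (kappaH_uniq v). Qed.

Lemma bot_eq (a : D) (u v : hom bot a) : u = v.
Proof. by rewrite -(kappaC_uniq u) (kappaC_uniq v). Qed.

End Pairing.

(** * The interpretation of formulae in pointed sets *)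

(** The coproduct of pointed sets identifies the two base points. The plain
    sum used for [Or] keeps them apart: they realize the same arrow and have
    the same support, so the quotient would change nothing. *)
Fixpoint elt (A : formula) : Type :=
  match A with
  | Letter _ => bool
  | Top | Bot => unit
  | And A1 A2 => elt A1 * elt A2
  | Or A1 A2 => elt A1 + elt A2
  end.

Fixpoint base (A : formula) : elt A :=
  match A return elt A with
  | Letter _ => false
  | Top | Bot => tt
  | And A1 A2 => (base A1, base A2)
  | Or A1 A2 => inl (base A1)
  end.

Fixpoint act (A B : formula) (f : term A B) : elt A -> elt B :=
  match f in term A B return elt A -> elt B with
  | Id _ => id
  | WH _ => fun t => (t, t)
  | WC _ => fun t => match t with inl u | inr u => u end
  | K1H _ _ => fst
  | K2H _ _ => snd
  | K1C _ _ => inl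
  | K2C _ _ => inr
  | KappaH _ => fun=> tt
  | KappaC A => fun=> base A
  | Comp _ _ _ g f => act g \o act f
  | AndT _ _ _ _ f1 f2 => fun t => (act f1 t.1, act f2 t.2)
  | OrT _ _ _ _ f1 f2 => fun t =>
      match t with inl u => inl (act f1 u) | inr u => inr (act f2 u) end
  end.

Fixpoint supp (A : formula) : elt A -> pred 'I_(nletters A) :=
  match A return elt A -> pred 'I_(nletters A) with
  | Letter _ => fun t _ => t
  | Top | Bot => fun _ _ => false
  | And A1 A2 => fun t i =>
      match split i with inl j => supp t.1 j | inr j => supp t.2 j end
  | Or A1 A2 => fun t i =>
      match t, split i with
      | inl u, inl j => supp u j
      | inr u, inr j => supp u j
      | _, _ => false
      end
  end.

(** The element whose support is the singleton of the given occurrence. *)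
Fixpoint single (A : formula) : 'I_(nletters A) -> elt A :=
  match A return 'I_(nletters A) -> elt A with
  | Letter _ => fun=> true
  | Top | Bot => fun=> tt
  | And A1 A2 => fun i =>
      match split i with
      | inl j => (single j, base A2)
      | inr j => (base A1, single j)
      end
  | Or A1 A2 => fun i =>
      match split i with inl j => inl (single j) | inr j => inr (single j) end
  end.

Lemma split_lshift m n (i : 'I_m) : split (lshift n i) = inl i.
Proof. exact: (unsplitK (inl i)). Qed.

Lemma split_rshift m n (i : 'I_n) : split (rshift m i) = inr i.
Proof. exact: (unsplitK (inr i)). Qed.

Definition splitE := (split_lshift, split_rshift).

Lemma supp_base A i : supp (base A) i = false.
Proof.
elim: A i => //= A1 IH1 A2 IH2 i; case: split_ordP => j _ //; exact: IH1.
Qed.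

Lemma supp_single A (x i : 'I_(nletters A)) : supp (single x) i = (x == i).
Proof.
elim: A x i => [p|||A1 IH1 A2 IH2|A1 IH1 A2 IH2] x i /=.
- by rewrite !ord1.
- by case: x.
- by case: x.
- case: (split_ordP x) => j ->; case: (split_ordP i) => k -> /=;
    by rewrite ?IH1 ?IH2 ?supp_base ?eq_shift.
- case: (split_ordP x) => j ->; case: (split_ordP i) => k -> /=;
    by rewrite ?IH1 ?IH2 ?eq_shift.
Qed.

(** * The action of arrow terms on supports *)

Lemma exists_split m n (P : pred 'I_(m + n)) :
  [exists x, P x] = [exists x, P (lshift n x)] || [exists x, P (rshift m x)].
Proof.
apply/existsP/orP => [[x]|[|] /existsP[j Pj]]; last 2 first.
- by exists (lshift n j).
- by exists (rshift m j).
case: (split_ordP x) => j -> Pj; [left|right]; by apply/existsP; exists j.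
Qed.

Lemma existsF (T : finType) (P : pred T) : P =1 xpred0 -> [exists x, P x] = false.
Proof. by move=> P0; apply/existsP => -[x]; rewrite P0. Qed.

Lemma exists_eqr (T : finType) (P Q : pred T) (y : T) :
  Q =1 pred1 y -> [exists x, P x && Q x] = P y.
Proof.
move=> QE; apply/existsP/idP => [[x]|Py]; last by exists y; rewrite QE Py /= eqxx.
by rewrite QE => /andP[Px /eqP <-].
Qed.
Arguments exists_eqr {T P Q} y.

Lemma mem_juxt m1 n1 m2 n2 (R1 : {set 'I_m1 * 'I_n1}) (R2 : {set 'I_m2 * 'I_n2})
    (x : 'I_(m1 + m2)) (y : 'I_(n1 + n2)) :
  ((x, y) \in rel_juxt R1 R2) =
  match split x, split y with
  | inl i, inl j => (i, j) \in R1
  | inr i, inr j => (i, j) \in R2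
  | _, _ => false
  end.
Proof.
rewrite inE; apply/orP/idP => [[|] /imsetP[[i j] Rij /eqP]|].
- by rewrite xpair_eqE => /andP[/eqP-> /eqP->]; rewrite !splitE.
- by rewrite xpair_eqE => /andP[/eqP-> /eqP->]; rewrite !splitE.
case: split_ordP => i ->; case: split_ordP => j -> // Rij; [left|right];
  by apply/imsetP; exists (i, j).
Qed.

Lemma exists_juxt m1 n1 m2 n2 (R1 : {set 'I_m1 * 'I_n1}) (R2 : {set 'I_m2 * 'I_n2})
    (P1 : pred 'I_m1) (P2 : pred 'I_m2) (y : 'I_(n1 + n2)) :
  [exists x, match split x with inl i => P1 i | inr i => P2 i end
             && ((x, y) \in rel_juxt R1 R2)] =
  match split y with
  | inl j => [exists x, P1 x && ((x, j) \in R1)]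
  | inr j => [exists x, P2 x && ((x, j) \in R2)]
  end.
Proof.
rewrite exists_split.
under eq_existsb do rewrite mem_juxt split_lshift.
under [X in _ || X]eq_existsb do rewrite mem_juxt split_rshift.
case: split => j; last by rewrite existsF // => x; rewrite andbF.
by rewrite orbC existsF // => x; rewrite andbF.
Qed.

(** An element of a sum is supported like the element of the product whose
    other component has empty support; this reduces [Or] to [And]. *)
Lemma supp_inl A1 A2 (u : elt A1) :
  @supp (Or A1 A2) (inl u) =1 @supp (And A1 A2) (u, base A2).
Proof. by move=> i /=; case: split => j //; rewrite supp_base. Qed.

Lemma supp_inr A1 A2 (u : elt A2) :
  @supp (Or A1 A2) (inr u) =1 @supp (And A1 A2) (base A1, u).
Proof. by move=> i /=; case: split => j //; rewrite supp_base. Qed.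

(** This is where the arithmetic description of the graphs of the primitive
    arrow terms is matched with the maps between pointed sets. *)
Lemma supp_act A B (f : term A B) (t : elt A) (y : 'I_(nletters B)) :
  supp (act f t) y = [exists x, supp t x && ((x, y) \in G f)].
Proof.
elim: f t y => {A B}
  [A|A|A|A1 A2|A1 A2|A1 A2|A1 A2|A|A|A B C g IHg f IHf
  |A1 A2 B1 B2 f1 IH1 f2 IH2|A1 A2 B1 B2 f1 IH1 f2 IH2] t y /=.
- by rewrite (exists_eqr y) // => x; rewrite inE.
- case: split_ordP => j ->; rewrite (exists_eqr j) // => x; rewrite inE /=.
    by rewrite !modn_small.
  by rewrite modnDl !modn_small.
- rewrite exists_split /=.
  under eq_existsb do rewrite splitE inE /= !modn_small // eq_sym.
  under [X in _ || X]eq_existsb do rewrite splitE inE /= modnDl !modn_small // eq_sym.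
  case: t => u; first by rewrite orbC existsF // (exists_eqr y).
  by rewrite existsF // (exists_eqr y).
- rewrite exists_split /= orbC existsF => [|x]; last first.
    rewrite inE /= gtn_eqF ?andbF //; exact/ltn_addr.
  under eq_existsb do rewrite splitE inE /=.
  by rewrite (exists_eqr y).
- rewrite exists_split /= existsF => [|x]; last first.
    by rewrite inE /= ltn_eqF ?andbF //; exact/ltn_addl.
  under eq_existsb do rewrite splitE inE /= addnC eqn_add2r.
  by rewrite (exists_eqr y).
- case: split_ordP => j ->.
    by rewrite (exists_eqr j) // => x; rewrite inE eq_sym.
  rewrite existsF // => x; rewrite inE /= gtn_eqF ?andbF //; exact/ltn_addr.
- case: split_ordP => j ->.
    rewrite existsF // => x; rewrite inE /= ltn_eqF ?andbF //; exact/ltn_addl.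
  by rewrite (exists_eqr j) // => x; rewrite inE /= addnC eqn_add2r eq_sym.
- by rewrite existsF // => x; rewrite inE andbF.
- by rewrite supp_base existsF // => x; rewrite inE andbF.
- rewrite IHg; apply/existsP/existsP => [[z /andP[]]|[x /andP[tx]]].
    rewrite IHf => /existsP[x /andP[tx xz]] zy; exists x; rewrite tx inE /=.
    by apply/existsP; exists z; rewrite xz.
  rewrite inE /= => /existsP[z /andP[xz zy]]; exists z; rewrite zy andbT IHf.
  by apply/existsP; exists x; rewrite tx.
- by rewrite exists_juxt; case: split => j; rewrite ?IH1 ?IH2.
- case: t => u.
    under eq_existsb => x do rewrite [X in X && _](supp_inl _ x).
    rewrite exists_juxt; case: split => j /=; first exact: IH1.
    by rewrite existsF // => x; exact: (congr1 (andb^~ _) (supp_base x)).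
  under eq_existsb => x do rewrite [X in X && _](supp_inr _ x).
  rewrite exists_juxt; case: split => j /=; last exact: IH2.
  by rewrite existsF // => x; exact: (congr1 (andb^~ _) (supp_base x)).
Qed.

(** * Arrows from [meet a bot] and arrows to [join a top] *)

Section Realization.
Variables (D : dicartesian) (a : D).

Let val : nat -> D := fun=> a.

Fixpoint point (A : formula) : elt A -> hom (meet a bot) (interp_obj val A) :=
  match A return elt A -> hom (meet a bot) (interp_obj val A) with
  | Letter _ => fun t => if t then k1H a bot else kappaC a ∘ k2H a bot
  | Top => fun=> kappaH (meet a bot)
  | Bot => fun=> k2H a bot
  | And A1 A2 => fun t => pairm (point t.1) (point t.2)
  | Or A1 A2 => fun t =>
      match t with
      | inl u => k1C _ _ ∘ point u
      | inr u => k2C _ _ ∘ point u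
      end
  end.

(** Needed for [KappaC A], which sends the only element of [Bot], realized by
    [k2H a bot], to the base point of [A]. *)
Lemma point_base A : point (base A) = kappaC _ ∘ k2H a bot.
Proof.
elim: A => [p|||A1 IH1 A2 IH2|A1 IH1 A2 IH2] //=.
- exact: top_eq.
- by rewrite (bot_eq (kappaC bot) (idm bot)) comp1m.
- rewrite IH1 IH2 -meetm_pairm pairm_diag compmA.
  by congr (_ ∘ _); apply: bot_eq.
- by rewrite IH1 compmA; congr (_ ∘ _); apply: bot_eq.
Qed.

(** The naturality, triangular, terminal and initial equations settle the cases;
    composition is immediate because the right-hand side is again a [point],
    however many occurrences of letters it meets. *)
Lemma interp_point A B (f : term A B) (t : elt A) :
  interp val f ∘ point t = point (act f t).
Proof.
elim: f t => {A B}
  [A|A|A|A1 A2|A1 A2|A1 A2|A1 A2|A|A|A B C g IHg f IHf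
  |A1 A2 B1 B2 f1 IH1 f2 IH2|A1 A2 B1 B2 f1 IH1 f2 IH2] t /=.
- exact: comp1m.
- by rewrite pairm_diag.
- by case: t => u; rewrite compmA ?wC_k1C ?wC_k2C comp1m.
- exact: k1H_pairm.
- exact: k2H_pairm.
- by [].
- by [].
- exact: top_eq.
- by rewrite point_base.
- by rewrite -compmA IHf IHg.
- by rewrite meetm_pairm IH1 IH2.
- by case: t => u; rewrite compmA ?k1C_nat ?k2C_nat -compmA ?IH1 ?IH2.
Qed.

(** The arrow that erases everything: [probe y] uses it on the summands that do
    not contain [y]. *)
Let off (b : D) : hom b (join a top) := k2C a top ∘ kappaH b.

Fixpoint probe (A : formula) : 'I_(nletters A) -> hom (interp_obj val A) (join a top) :=
  match A return 'I_(nletters A) -> hom (interp_obj val A) (join a top) with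
  | Letter _ => fun=> k1C a top
  | Top | Bot => fun=> off _
  | And A1 A2 => fun y =>
      match split y with
      | inl j => probe j ∘ k1H _ _
      | inr j => probe j ∘ k2H _ _
      end
  | Or A1 A2 => fun y =>
      match split y with
      | inl j => copairm (probe j) (off _)
      | inr j => copairm (off _) (probe j)
      end
  end.

Lemma off_comp (b c : D) (u : hom b c) : off c ∘ u = off b.
Proof. by rewrite /off -compmA; congr (_ ∘ _); apply: top_eq. Qed.

Lemma off_meet : off (meet a bot) = k2C a top ∘ zero_bot_top ∘ k2H a bot.
Proof. by rewrite off_comp. Qed.

(** At a letter, the base point gives an arrow that passes through [bot], hence
    the second arrow by initiality; on a wrong summand, [off] gives it by
    terminality. *)
Lemma probe_point A (y : 'I_(nletters A)) (t : elt A) :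
  probe y ∘ point t =
  if supp t y then k1C a top ∘ k1H a bot
  else k2C a top ∘ zero_bot_top ∘ k2H a bot.
Proof.
elim: A y t => [p|||A1 IH1 A2 IH2|A1 IH1 A2 IH2] y t /=;
  (* Simplification leaves unfolded copies of these fixpoints in the types,
     which would hide some of the occurrences of [split y]. *)
  rewrite -?/nletters -?/interp_obj -?/elt -?/supp.
- case: t => //; rewrite compmA; congr (_ ∘ _); exact: bot_eq.
- by case: y.
- by case: y.
- by case: split => j; rewrite -compmA ?k1H_pairm ?k2H_pairm.
- by case: split => j; case: t => u;
    rewrite compmA ?copairm_k1C ?copairm_k2C ?off_comp ?off_meet.
Qed.

(** The graph of an arrow term can be read off in [D], unless the two arrows
    are equal there. *)
Lemma probe_interp_point A B (f : term A B) x y :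
  probe y ∘ interp val f ∘ point (single x) =
  if (x, y) \in G f then k1C a top ∘ k1H a bot
  else k2C a top ∘ zero_bot_top ∘ k2H a bot.
Proof.
rewrite -compmA interp_point probe_point supp_act.
under eq_existsb do rewrite supp_single eq_sym andbC.
by rewrite (exists_eqr x).
Qed.

End Realization.

(** * Collapse *)

Theorem mainTheorem14 (A B : formula) (f g : term A B) (hG : G f <> G g)
    (D : dicartesian) (hD : satisfies D f g) :
  (forall a : D,
     k1C a top ∘ k1H a bot = k2C a top ∘ zero_bot_top ∘ k2H a bot) /\
  (forall (a b : D) (u v : hom a b),
     k1C b top ∘ u ∘ k1H a bot = k1C b top ∘ v ∘ k1H a bot).
Proof.
have collapse (a : D) :
    k1C a top ∘ k1H a bot = k2C a top ∘ zero_bot_top ∘ k2H a bot.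
  have [[x y] neq_xy|eqG] := pickP (fun p => (p \in G f) != (p \in G g)); last first.
    by case: hG; apply/setP => p; apply/eqP/negbFE/eqG.
  move: neq_xy.
  have := probe_interp_point a f x y; rewrite hD probe_interp_point.
  by case: ((x, y) \in G f); case: ((x, y) \in G g).
split=> // a b u v.
suff absorb (w : hom a b) :
    k1C b top ∘ w ∘ k1H a bot = k2C b top ∘ zero_bot_top ∘ k2H a bot.
  by rewrite !absorb.
(* Naturality moves [w] past both injections, and on [top] it disappears. *)
rewrite -(k1C_nat w (idm top)) -compmA collapse !compmA k2C_nat.
by rewrite compm1.
Qed.
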